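(* For all integers $k\ge 3$ and $n\ge 1$, $$r_{bip}(S(n,n);k)\le \left\lfloor\left(1+\sqrt{1-\frac{2}{k}}\right)kn\right\rfloor+1.$$
   Context: All graphs are finite, simple and undirected. For positive integers $n,m$, the double star $S(n,m)$ is the graph consisting of the disjoint union of two stars $K_{1,n}$ and $K_{1,m}$ together with an edge joining their centers; $S(n,n)$ is the case $m=n$. A $k$-edge-coloring of a graph $G$ is any function $\tau:E(G)\to\{1,\dots,k\}$ (not necessarily proper). The $k$-color bipartite Ramsey number $r_{bip}(H;k)$ of a bipartite graph $H$ is the smallest integer $N$ such that every $k$-edge-coloring of the complete bipartite graph $K_{N,N}$ contains a monochromatic copy of $H$ (as a not necessarily induced subgraph). *)

(* Defs.v *)
From HB Require Import structures.
From mathcomp Require Import all_boot all_order all_algebra.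
From mathcomp Require Import reals.

Set Implicit Arguments.
Unset Strict Implicit.
Unset Printing Implicit Defensive.

Record sgraph := SGraph {
  vertex :> finType;
  adj : rel vertex;
  adj_sym : symmetric adj;
  adj_irr : irreflexive adj }.

Definition edges (G : sgraph) : {set {set G}} :=
  [set [set p.1; p.2] | p : G * G & adj p.1 p.2].

Definition edge (G : sgraph) := {e : {set G} | e \in edges G}.

Definition edge_coloring (G : sgraph) (k : nat) := edge G -> 'I_k.

(* The two-element set [set f x; f y] being an edge of G says that f x and f y
   are adjacent, so f is an embedding of H as a not necessarily induced
   subgraph. *)
Definition monochromatic_copy (H G : sgraph) (k : nat)
    (tau : edge_coloring G k) : Prop :=
  exists (f : H -> G) (c : 'I_k), injective f /\
    forall x y : H, adj x y ->
      exists2 e : edge G, val e = [set f x; f y] & tau e = c.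

Section CompleteBipartite.
Variables a b : nat.

Definition Kab_adj (u v : 'I_a + 'I_b) : bool :=
  match u, v with
  | inl _, inr _ | inr _, inl _ => true
  | _, _ => false
  end.

Lemma Kab_adj_sym : symmetric Kab_adj.
Proof. by move=> [?|?] [?|?]. Qed.

Lemma Kab_adj_irr : irreflexive Kab_adj.
Proof. by move=> [?|?]. Qed.

Definition complete_bipartite : sgraph := SGraph Kab_adj_sym Kab_adj_irr.

End CompleteBipartite.

Section JoinByEdge.
Variables (G H : sgraph) (g : G) (h : H).

Definition join_adj (u v : G + H) : bool :=
  match u, v with
  | inl x, inl y => adj x y
  | inr x, inr y => adj x y
  | inl x, inr y | inr y, inl x => (x == g) && (y == h)
  end.

Lemma join_adj_sym : symmetric join_adj.
Proof. by move=> [x|x] [y|y] //=; rewrite adj_sym. Qed.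

Lemma join_adj_irr : irreflexive join_adj.
Proof. by move=> [x|x] /=; rewrite adj_irr. Qed.

(* The disjoint union of G and H together with the edge gh. *)
Definition join_by_edge : sgraph := SGraph join_adj_sym join_adj_irr.

End JoinByEdge.

Definition star (n : nat) : sgraph := complete_bipartite 1 n.

Definition center (n : nat) : star n := inl ord0.

Definition double_star (n m : nat) : sgraph :=
  join_by_edge (center n) (center m).

Definition bip_arrows (H : sgraph) (k N : nat) : Prop :=
  forall tau : edge_coloring (complete_bipartite N N) k,
    monochromatic_copy H tau.

(* N = r_bip(H; k).  The number is given by its graph, so no junk value arises
   when no N works; asserting r_bip(H; k) <= B means asserting that some N
   satisfies this predicate and N <= B. *)
Definition is_bip_ramsey (H : sgraph) (k N : nat) : Prop :=
  bip_arrows H k N /\ forall M : nat, bip_arrows H k M -> N <= M.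

(* Main.v *)
Require Import Defs.
From HB Require Import structures.
From mathcomp Require Import all_boot all_order all_algebra.
From mathcomp Require Import reals.
From mathcomp Require Import boolp zify ring lra.
Import Order.TTheory GRing.Theory Num.Theory.
Local Open Scope ring_scope.

Set Implicit Arguments.
Unset Strict Implicit.
Unset Printing Implicit Defensive.

(** Fix a colour c and let A and B be the sets of vertices of c-degree above n
  on the two sides of K_{N,N}, with a = |A| and b = |B|.  A monochromatic
  S(n,n) in colour c is the same as a c-edge between A and B.  If there is
  none, the number e of c-edges is at most n(N-a) + a(N-b), n(N-b) + b(N-a)
  and n(N-a) + n(N-b).  If a, b >= n the last bound gives e <= 2n(N-n); if,
  say, a <= b and a < n, then e <= nN + a(N-n-a), and this is at most 2n(N-n)
  as soon as N >= 3n.  Summing over the colours, N^2 <= 2kn(N-n), which fails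
  beyond the larger root k(1 + sqrt(1 - 2/k))n of N^2 - 2knN + 2kn^2. *)

Section HighDegree.
Local Open Scope nat_scope.

(** The threshold is strict because a centre of S(n,n) has n leaves and the other centre as
    neighbours. *)
Definition high_degree (U V : finType) (r : U -> V -> bool) (n : nat) :
  {set U} := [set u | n < \sum_v r u v].

Definition transpose (U V : finType) (r : U -> V -> bool) (v : V) (u : U) :=
  r u v.

Lemma sum_low_degree (U V : finType) (r : U -> V -> bool) (n : nat) :
  \sum_(u | u \notin high_degree r n) \sum_v r u v <=
  (#|U| - #|high_degree r n|) * n.
Proof.
rewrite -[X in X - _](cardsC (high_degree r n)) addKn -sum_nat_const.
rewrite (eq_bigl (mem (~: high_degree r n))).
  by apply: leq_sum => u; rewrite !inE -leqNgt.
by move=> u; rewrite !inE.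
Qed.

Section Bounds.
Variables (U V : finType) (r : U -> V -> bool) (n : nat).
Let A := high_degree r n.
Let B := high_degree (transpose r) n.
Hypothesis noAB : forall u v, u \in A -> v \in B -> ~~ r u v.

Lemma sum_high_row u : u \in A -> \sum_v r u v = \sum_(v | v \notin B) r u v.
Proof.
move=> uA; rewrite (bigID (mem B)) /= big1 ?add0n // => v vB.
by rewrite (negPf (noAB uA vB)).
Qed.

(** Edges are counted from the side of [U]: those at a vertex of [A] all end outside [B], and every
    other vertex has degree at most n. *)
Lemma edges_le_one_side :
  \sum_u \sum_v r u v <= #|A| * (#|V| - #|B|) + (#|U| - #|A|) * n.
Proof.
rewrite (bigID (mem A)) /= leq_add ?sum_low_degree //.
rewrite -sum_nat_const; apply: leq_sum => u uA; rewrite sum_high_row //.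
rewrite -(cardsC B) addKn -sum1_card (eq_bigl (mem (~: B))) => [|v]; last by rewrite !inE.
by apply: leq_sum => v _; case: (r u v).
Qed.

(** Edges leaving [A] end outside [B], so they can be charged to their endpoints in [V], each of
    degree at most n. *)
Lemma edges_le_both_sides :
  \sum_u \sum_v r u v <= (#|V| - #|B|) * n + (#|U| - #|A|) * n.
Proof.
rewrite (bigID (mem A)) /= leq_add ?sum_low_degree //.
apply: leq_trans (sum_low_degree (transpose r) n).
rewrite (eq_bigr _ sum_high_row) exchange_big /=; apply: leq_sum => v _.
by rewrite [leqRHS](bigID (mem A)) /= leq_addr.
Qed.

End Bounds.

Lemma edges_le (U V : finType) (r : U -> V -> bool) (n N : nat) :
    #|U| = N -> #|V| = N -> 3 * n <= N ->
    (forall u v, u \in high_degree r n ->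
       v \in high_degree (transpose r) n -> ~~ r u v) ->
  \sum_u \sum_v r u v <= 2 * n * (N - n).
Proof.
move=> cU cV leN noAB.
have e1 := edges_le_one_side noAB.
have e2 := edges_le_both_sides noAB.
(* Exchanging the two sides gives the same bound with a and b swapped. *)
have /edges_le_one_side : forall v u,
    v \in high_degree (transpose r) n ->
    u \in high_degree (transpose (transpose r)) n ->
    ~~ transpose r v u by move=> v u vB uA; exact: noAB.
rewrite exchange_big /=.
have := max_card (mem (high_degree r n)).
have := max_card (mem (high_degree (transpose r) n)).
move: e1 e2; rewrite -[transpose (transpose r)]/r cU cV.
change (\sum_j \sum_i transpose r i j) with (\sum_j \sum_i r j i).
move: (\sum_u _) #|_| #|_| => e b a e1 e2 bN aN e3.
(* Replacing y by x leaves (N - x)(x + n), which increases in x up to (N - n)/2. As N >= 3n, this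
   range contains n, where the value is 2n(N - n). Writing N = M + 3n and n = x + d removes the
   truncated subtractions. *)
have key x y : x < n -> x <= y -> y <= N ->
    e <= x * (N - y) + (N - x) * n -> e <= 2 * n * (N - n).
  move=> xn xy yN /leq_trans; apply.
  have -> : N - n = (N - 3 * n) + 2 * n by lia.
  apply: (@leq_trans (x * (N - x) + (N - x) * n)).
    by rewrite leq_add2r leq_mul2l leq_sub2l ?orbT.
  have -> : N = (N - 3 * n) + 3 * n by lia.
  have [d ->] : exists d, n = x + d by exists (n - x); lia.
  set M := N - _; have -> : M + 3 * (x + d) - x = M + 2 * x + 3 * d by lia.
  have -> : M + 3 * (x + d) - 3 * (x + d) = M by lia.
  nia.
case: (ltnP a n) => an; case: (ltnP b n) => bn.
- case: (leqP a b) => ab; first exact: key an ab bN e1.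
  exact: key bn (ltnW ab) aN e3.
- exact: key an (leq_trans (ltnW an) bn) bN e1.
- exact: key bn (leq_trans (ltnW bn) an) aN e3.
apply: leq_trans e2 _.
rewrite -mulnDl mulnC -mulnA mulnCA leq_mul2l; apply/orP; right; lia.
Qed.

End HighDegree.

Section DoubleStar.
Local Open Scope nat_scope.

Lemma Kab_edge_subproof a b (u : 'I_a) (v : 'I_b) :
  [set inl u; inr v] \in edges (complete_bipartite a b).
Proof. by apply/imsetP; exists (inl u, inr v); rewrite ?inE. Qed.

Definition Kab_edge a b (u : 'I_a) (v : 'I_b) : edge (complete_bipartite a b) :=
  Sub [set inl u; inr v] (Kab_edge_subproof u v).

(** This selects the leaves at one centre; [v] stands for the other centre, and the strict bound
    leaves n choices once it is discarded. *)
Lemma inj_avoiding (V : finType) (p : V -> bool) (v : V) (n : nat) :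
    n < \sum_w p w ->
  exists2 g : 'I_n -> V, injective g & forall i, p (g i) /\ g i != v.
Proof.
move=> lt_n; pose S := [set w | p w] :\ v.
have leS : n <= #|S|.
  rewrite -ltnS (leq_trans lt_n) //.
  have -> : \sum_w p w = #|[set w | p w]|.
    by rewrite -sum1dep_card [RHS]big_mkcond; apply: eq_bigr => w _; case: (p w).
  by rewrite (cardsD1 v) -add1n leq_add2r leq_b1.
(* The default [v] of [nth] is never returned, since i < n <= |S|. *)
have memS (i : 'I_n) : nth v (enum S) i \in S.
  by rewrite -mem_enum mem_nth // -cardE (leq_trans (ltn_ord i)).
exists (fun i : 'I_n => nth v (enum S) i) => [i j /eqP|i]; last first.
  by have := memS i; rewrite !inE => /andP[].
rewrite nth_uniq ?enum_uniq -?cardE ?(leq_trans (ltn_ord _)) // => /eqP.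
exact: val_inj.
Qed.

(** The centres are [u] and [v]. The two sets of leaves lie on opposite sides, so a leaf could only
    collide with the centre it is not attached to, and [inj_avoiding] excludes that. *)
Lemma double_star_copy (n m k N : nat)
    (tau : edge_coloring (complete_bipartite N N) k) (c : 'I_k) (u v : 'I_N) :
    tau (Kab_edge u v) = c ->
    n < \sum_w (tau (Kab_edge u w) == c) ->
    m < \sum_w (tau (Kab_edge w v) == c) ->
  monochromatic_copy (double_star n m) tau.
Proof.
move=> cuv /(inj_avoiding v)[g gI gP] /(inj_avoiding u)[h hI hP].
pose f (x : double_star n m) : complete_bipartite N N :=
  match x with
  | inl (inl _) => inl u
  | inl (inr i) => inr (g i)
  | inr (inl _) => inr v
  | inr (inr j) => inl (h j)
  end.
have gv i : g i <> v by case: (gP i) => _ /eqP.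
have hu j : h j <> u by case: (hP j) => _ /eqP.
have cg i : tau (Kab_edge u (g i)) = c by case: (gP i) => /eqP.
have ch j : tau (Kab_edge (h j) v) = c by case: (hP j) => /eqP.
exists f, c; split.
  move=> [[i|i]|[i|i]] [[j|j]|[j|j]] //=; rewrite ?(ord1 i) ?(ord1 j) //.
  - by case=> /esym /hu.
  - by case=> /gI ->.
  - by case=> /gv.
  - by case=> /esym /gv.
  - by case=> /hu.
  - by case=> /hI ->.
move=> [[i|i]|[i|i]] [[j|j]|[j|j]] //=; rewrite ?andbF // => _.
- by exists (Kab_edge u (g j)).
- by exists (Kab_edge u v).
- by exists (Kab_edge u (g i)) => //=; rewrite setUC.
- by exists (Kab_edge u v) => //=; rewrite setUC.
- by exists (Kab_edge (h j) v) => //=; rewrite setUC.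
- by exists (Kab_edge (h i) v).
Qed.

Lemma double_star_arrows (k n N : nat) :
  3 * n <= N -> 2 * k * n * (N - n) < N * N ->
  bip_arrows (double_star n n) k N.
Proof.
move=> leN ltN tau; apply: contrapT => noS; move: ltN; apply/negP; rewrite -leqNgt.
pose r c u v := tau (Kab_edge u v) == c.
have -> : N * N = \sum_(u < N) \sum_(v < N) 1.
  by rewrite !sum_nat_const !card_ord muln1.
(* Each edge is counted in exactly one colour class. *)
have -> : \sum_(u < N) \sum_(v < N) 1 = \sum_c \sum_u \sum_v r c u v.
  rewrite [RHS]exchange_big; apply: eq_bigr => u _; rewrite [RHS]exchange_big.
  apply: eq_bigr => v _; rewrite (bigD1 (tau (Kab_edge u v))) //= /r eqxx.
  by rewrite big1 // => c /negPf; rewrite eq_sym => ->.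
have -> : 2 * k * n * (N - n) = \sum_(c < k) 2 * n * (N - n).
  by rewrite sum_nat_const card_ord; ring.
apply: leq_sum => c _; apply: edges_le; rewrite ?card_ord // => u v.
rewrite !inE => hu hv; apply/negP => /eqP cuv.
exact/noS/(double_star_copy cuv hu hv).
Qed.

End DoubleStar.

(** The least arrowing number exists by well-ordering; [asbool] turns the predicate into a boolean
    one for [ex_minnP]. *)
Lemma exists_is_bip_ramsey (H : sgraph) (k M : nat) :
  bip_arrows H k M -> exists2 N, is_bip_ramsey H k N & (N <= M)%N.
Proof.
move=> HM; have exN : exists N, `[< bip_arrows H k N >] by exists M; apply/asboolP.
case: (ex_minnP exN) => N /asboolP HN minN; exists N; last exact/minN/asboolP.
by split=> // L HL; apply/minN/asboolP.
Qed.

(** Completing the square, the second claim says (x - kn)^2 > k(k - 2)n^2, and the right-hand side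
    is (skn)^2 with s the square root. The first follows from 3n <= kn <= (1 + s)kn. *)
Lemma ramsey_quadratic (R : rcfType) (k n x : R) :
  3 <= k -> 0 < n -> (1 + Num.sqrt (1 - 2 / k)) * k * n < x ->
  3 * n <= x /\ 2 * k * n * (x - n) < x * x.
Proof.
move=> k3 n0; set s := Num.sqrt _ => ltx.
have s0 : 0 <= s := sqrtr_ge0 _.
have k0 : 0 < k by lra.
have s2 : s ^+ 2 * k = k - 2.
  rewrite sqr_sqrtr; first by field; lra.
  by rewrite subr_ge0 ler_pdivrMr //; lra.
have kn : 3 * n <= k * n by rewrite ler_pM2r.
have skn : 0 <= s * k * n by rewrite !mulr_ge0 ?(ltW k0) ?(ltW n0).
split; first by lra.
have : (s * k * n) ^+ 2 < (x - k * n) ^+ 2.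
  by rewrite ltr_pXn2r ?nnegrE //; lra.
have -> : (s * k * n) ^+ 2 = (s ^+ 2 * k) * k * n ^+ 2 by ring.
by rewrite s2; lra.
Qed.

Theorem corollary1p4 (R : realType) (k n : nat)
    (hk : (3 <= k)%N) (hn : (1 <= n)%N) :
  exists2 N : nat, is_bip_ramsey (double_star n n) k N &
    N%:Z <= Num.floor ((1 + Num.sqrt (1 - 2 / k%:R)) * k%:R * n%:R : R) + 1.
Proof.
set y : R := _ * n%:R.
have y0 : 0 <= y by rewrite !mulr_ge0 ?addr_ge0 ?sqrtr_ge0.
have [M EM] : exists M : nat, Num.floor y + 1 = M%:Z.
  exists (absz (Num.floor y + 1)); rewrite gez0_abs //.
  by rewrite addr_ge0 // floor_ge0.
(* The added 1 makes M exceed y strictly, as the quadratic inequality requires. *)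
have ltM : y < M%:R by have := floorD1_gt y; rewrite EM.
have [] : 3 * n%:R <= M%:R :> R /\
    2 * k%:R * n%:R * (M%:R - n%:R) < M%:R * M%:R :> R.
  by apply: ramsey_quadratic ltM; rewrite ?ltr0n // ler_nat.
rewrite -natrM ler_nat => leM ltM2.
have /exists_is_bip_ramsey[N HN leN] : bip_arrows (double_star n n) k M.
  apply: double_star_arrows => //.
  (* The natural subtraction M - n is not truncated, since n <= 3n <= M. *)
  by rewrite -(ltr_nat R) !natrM natrB //; lia.
by exists N; rewrite // EM lez_nat.
Qed.
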